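(* Fix a finite geometric scale chain $D_0\to D_1\to\cdots\to D_K$ generated by normalized local Navier--Stokes data. Assume: (a) for every $k=0,\dots,K-1$ the one-step admissibility hypotheses (listed in the context) hold for the transition $D_k\to D_{k+1}$, with ledger $\Delta_k=\Delta_k^{\mathrm{sync}}+\Delta_k^{\mathrm{loc},\mathrm{EF}}+\Delta_k^{\mathrm{proj}}+\Delta_k^{\mathrm{harm}}+\Delta_k^{\mathrm{chart}}+\Delta_k^{\mathrm{gap}}+\Delta_k^{\mathrm{gate}}+\Delta_k^{\mathrm{det}}$; (b) the static audit certificate $M_k\ge c_k\delta_k-E_k$ holds at every scale $k=0,\dots,K$; (c) there are constants $a_k,b_k,\eta_k\ge0$ with $E_{k+1}\le a_kE_k+b_k\Delta_k$ and $c_{k+1}\ge c_k-\eta_k$ for $0\le k\le K-1$; (d) the coefficient drift is controlled (in the sense of the context), or equivalently the accumulated coefficient loss keeps $c_K^{\min}:=\min_{0\le k\le K}c_k>0$ on the considered finite chain; (e) projection-tail control is supplied at each scale either by compactness of the selected pressure image, by an effective projection bound, or by the projection-tail drift estimate (see context); (f) chart visibility and the clean detector gap are supplied by the compact quotient criteria (see context); in the pressure--flux--energy (PFE) realization the clean gap is supplied by the PFE compact quotient clean gap, under the kernel condition $\ker T_{\Lambda,k}^{\mathrm{PFE}}=G_{\Lambda,k}^{\mathrm{cl}}$. Then, for every choice of weights $w_k\ge0$, $$\sum_{k=0}^Kw_kM_k\ge c_K^{\min}\sum_{k=0}^Kw_k\delta_k-E_K^{\mathrm{rec}},\qquad E_K^{\mathrm{rec}}:=\sum_{k=0}^Kw_kE_k,$$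 and for every $0\le k\le K$, $$E_k\le\Bigl(\prod_{i=0}^{k-1}a_i\Bigr)E_0+\sum_{j=0}^{k-1}b_j\Bigl(\prod_{i=j+1}^{k-1}a_i\Bigr)\Delta_j$$ (empty products are $1$). In particular, either $\sum_{k=0}^Kw_kM_k\ge\frac{c_K^{\min}}2\sum_{k=0}^Kw_k\delta_k$, or $E_K^{\mathrm{rec}}\ge\frac{c_K^{\min}}2\sum_{k=0}^Kw_k\delta_k$.
   Context: **Packages.** Fix $0<\lambda<1$, $r_k=\lambda^kr_0$, a fixed center $(x_0,t_0)$, $Q_1=B_1\times(-1,0)\subset\mathbb R^3\times\mathbb R$; $u_k(y,s)=r_ku(x_0+r_ky,t_0+r_k^2s)$, $p_k(y,s)=r_k^2p(x_0+r_ky,t_0+r_k^2s)$. A package $D_k$ (class $\mathcal A_k^{\mathrm{NS}}$) is generated by such data with $u_k\in L^3(Q_1)^3\cap L^\infty((-1,0);L^2(B_1))^3$, $\nabla u_k\in L^2(Q_1)$, $p_k\in L^{3/2}(Q_1)$, $-\Delta p_k=\partial_i\partial_j(u_{k,i}u_{k,j})$ modulo time-dependent constants, the local energy inequality of suitable weak solutions, and carries finite audit coordinates $(U_k,P_k^{\mathrm{act}},P_k^{\mathrm{harm}},S_k,L_k,G_k,\zeta_k,M_k,\delta_k,E_k)$: velocity, active and harmonic pressure, source, localization, gate/slack, synchronized representative, detector value $M_k$, baseline defect distance $\delta_k=\operatorname{dist}_{0,k}(D_k,\Gamma^{\mathrm{int}}_{\Lambda,k})\ge0$ to the gauge class, residual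 budget $E_k$. $c_k\ge0$ is the audit coefficient, schematically $c_k=\mu_{\Lambda,k}^{\mathrm{comp}}\lambda_{G,k}-L_k^{\mathrm{res}}$ (clean gap constant times chart visibility constant minus residual-loss coefficient). **Notation for the steps.** $X_{\mathrm{src}}=L^{3/2}((-1,0);L^{3/2}(B_1))^{3\times3}$, $Y_{\mathrm{prs}}=L^{3/2}((-1,0);L^{3/2}(B_{1/2}))$, $Y_{\mathrm{harm}}=L^{3/2}((-1,0);L^{3/2}(B_{3/4}))$; $R_j=\partial_j(-\Delta)^{-1/2}$ (functions extended by zero outside $B_1$); $\eta,\chi\in C_c^\infty(B_1)$ equal to $1$ on $B_{3/4}$, $\theta\in C_c^\infty((-1,0])$, $\phi=\theta\chi$, $A_\eta=B_1\cap\operatorname{supp}(1-\eta)$, $A_\chi=\operatorname{supp}\nabla\chi\cup\operatorname{supp}\Delta\chi$, $\Omega_\chi=\operatorname{supp}\chi$; $F_k^{\mathrm{act}}=\eta u_k\otimes u_k$, $\widetilde P_k^{\mathrm{act}}=R_iR_jF^{\mathrm{act}}_{k,ij}$, $P_k^{\mathrm{act}}=\widetilde P_k^{\mathrm{act}}|_{B_{1/2}}$, $P_k^{\mathrm{harm}}=(p_k-\widetilde P_k^{\mathrm{act}})|_{B_{3/4}}$; $\mathsf{Leak}_{k\to k+1}^{\mathrm{EF}}=\int_{-\lambda^2}^0\int_{\lambda\Omega_\chi}(|u_k|^2+|\nabla u_k|^2)+\int_{-\lambda^2}^0\int_{\lambda A_\chi}(|u_k|^2+|u_k|^3+|p_k||u_k|)$.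 **One-step admissibility hypotheses for $D_k\to D_{k+1}$.** $D_k\in\mathcal A_k^{\mathrm{NS}}$; $D_{k+1}=\mathcal R_kD_k$ is obtained by restriction, rescaling to $Q_1$, selection of $\zeta_{k+1}$ and recomputation of all coordinates; and: the coordinates $u_k,F_k^{\mathrm{act}},P_k^{\mathrm{act}},P_k^{\mathrm{harm}}$ lie in $L^3(Q_1)^3,X_{\mathrm{src}},Y_{\mathrm{prs}},Y_{\mathrm{harm}}$ with $P_k^{\mathrm{harm}}$ harmonic where $\eta=1$; $\Delta_k^{\mathrm{loc},\mathrm{EF}}\ge C_{\lambda,\chi,\theta}\mathsf{Leak}^{\mathrm{EF}}_{k\to k+1}$; pressure recomputation is charged by $\|[\eta,R_iR_j](u_{k,i}u_{k,j})\|_{Y_{\mathrm{prs}}}\le C_\eta\|u_k\otimes u_k\|_{L^{3/2}((-1,0)\times A_\eta)}$; $\Delta_k^{\mathrm{sync}}\ge d_{\Gamma,k+1}(\zeta_{k+1},T_k^\Gamma\zeta_k)+\varepsilon_k+\varepsilon_{k+1}$, where $\zeta_k\in\Gamma_{\Lambda,k}^{\mathrm{int}}$ is an $\varepsilon_k$-near minimizer of $|D_k-\cdot|_{0,k}$, $T_k^\Gamma$ a chosen gauge-transport map, $d_{\Gamma,k+1}$ a gauge discrepancy functional; $\Delta_k^{\mathrm{proj}}\ge\|(I-P_{N,k+1}^{\mathrm{cl}})\mathsf P_{k+1}^{\mathrm{cl}}\|_{Y_{\mathrm{prs}}}$ and $\Delta_k^{\mathrm{harm}}\ge\|(I-H_{M,k+1}^{\mathrm{harm}})\mathsf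 H_{k+1}^{\mathrm{harm}}\|_{Y_{\mathrm{harm}}}$ for selected clean pressure and harmonic-tail observations and chosen finite-rank maps; $\Delta_k^{\mathrm{gate}}\ge\operatorname{dist}(\mathsf G_{k+1},\mathcal K_{\mathrm{gate},k+1})$ for the gate coordinate and closed admissible gate set in a finite-dimensional normed space; the detector channel is realized by a reduced PFE comparison: finite-dimensional maps $\Theta,T^{\mathrm{loc}},T^{\mathrm{PFE}},J$ with $\|T^{\mathrm{PFE}}\Theta D-JT^{\mathrm{loc}}D\|\le C_{\mathrm{res},k}\mathrm{Err}_{\mathrm{red},k}(D)+\Delta_{\mathrm{det},k}$, $\|T^{\mathrm{loc}}D\|\ge c_{J,k}\|JT^{\mathrm{loc}}D\|-\Delta_{J,k}$ ($c_{J,k}>0$), and $\Delta_k^{\mathrm{det}}\ge c_{J,k}C_{\mathrm{res},k}\mathrm{Err}_{\mathrm{red},k}(D_k^{N,\mathrm{loc}})+c_{J,k}\Delta_{\mathrm{det},k}+\Delta_{J,k}$, with $D_k^{N,\mathrm{loc}}$ the reduced coordinate of $D_k-\zeta_k$; and the given chart and clean-gap mismatches satisfy $\mathrm{ChartErr}_k\le\Delta_k^{\mathrm{chart}}$, $\mathrm{GapErr}_k\le\Delta_k^{\mathrm{gap}}$. **Coefficient drift (d).** With $c_k=\mu_k\lambda_k-\ell_k$ there are $\delta_{\mu,k},\delta_{\lambda,k},\delta_{\ell,k}\ge0$ with $\mu_{k+1}\ge(\mu_k-\delta_{\mu,k})_+$, $\lambda_{k+1}\ge(\lambda_k-\delta_{\lambda,k})_+$,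 $\ell_{k+1}\le\ell_k+\delta_{\ell,k}$, giving loss $\eta_k^{\mathrm{coeff}}=\mu_k\lambda_k-(\mu_k-\delta_{\mu,k})_+(\lambda_k-\delta_{\lambda,k})_++\delta_{\ell,k}$ and $c_{k+1}\ge c_k-\eta_k^{\mathrm{coeff}}$. **Projection-tail control (e).** With $\mathcal G_{k,0}^{\mathrm{NS}}\subset Y_{\mathrm{prs}}$ the set of selected clean pressure images $R_iR_jF_{ij}|_{B_{1/2}}$ and $\Delta_{k,\mathrm{proj},N}^{\mathrm{unif}}=\sup_{g\in\mathcal G_{k,0}^{\mathrm{NS}}}\|(I-P_{N,k}^{\mathrm{cl}})g\|_{Y_{\mathrm{prs}}}$: either $\mathcal G_{k,0}^{\mathrm{NS}}$ is precompact and the finite-rank $P_{N,k}^{\mathrm{cl}}$ are uniformly bounded and converge strongly to $I$; or $\Delta_{k,\mathrm{proj},N}^{\mathrm{unif}}\le\varepsilon_{k,N}\to0$; or $\Delta_{k+1,\mathrm{proj},N}^{\mathrm{unif}}\le(1+C_{P,k+1})\delta_k^{\mathrm{img}}+C_{T,k}\Delta_{k,\mathrm{proj},N}^{\mathrm{unif}}+\omega_{k,N}^{\mathrm{proj}}$ for a bounded pressure transport map with norm $C_{T,k}$, image defect $\delta_k^{\mathrm{img}}$, commutator size $\omega_{k,N}^{\mathrm{proj}}$, and $C_{P,k+1}=\|P_{N,k+1}^{\mathrm{cl}}\|$. **Chart visibility and clean gap (f).** Chart visibility: $V_k(D_k)\ge\lambda_{G,k}\delta_k$ with $\lambda_{G,k}>0$,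 where $V_k(D_k)$ is the distance of the clean chart image of $D_k-\zeta_k$ to the clean gauge subspace, obtained from compactness of the unit quotient section, lower semicontinuity, homogeneity and kernel-freeness of $V_k$. Clean gap: $M_{\Lambda,k}^{\mathrm{comp}}(D^{\mathrm{cl}})\ge\mu_{\Lambda,k}^{\mathrm{comp}}\operatorname{dist}_{\mathrm{cl}}(D^{\mathrm{cl}},\Gamma^{\mathrm{cl}}_{\Lambda,k})$ with $\mu_{\Lambda,k}^{\mathrm{comp}}>0$, obtained likewise for the clean detector $M_{\Lambda,k}^{\mathrm{comp}}$; in the PFE realization the detector is built from the finite-dimensional linear PFE detector/tax map $T_{\Lambda,k}^{\mathrm{PFE}}$ and the clean gauge is the subspace $G_{\Lambda,k}^{\mathrm{cl}}$, and $\mu_{\Lambda,k}^{\mathrm{comp}}=\mu_{\Lambda,k}^{\mathrm{PFE}}$. *)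

(* Defs.v *)
From HB Require Import structures.
From mathcomp Require Import all_boot all_order all_algebra.
From mathcomp Require Import all_classical all_reals all_analysis.
From mathcomp Require Import ess_sup_inf.

Set Implicit Arguments.
Unset Strict Implicit.
Unset Printing Implicit Defensive.

Import Order.TTheory GRing.Theory Num.Theory.
Import numFieldNormedType.Exports.

Local Open Scope classical_set_scope.
Local Open Scope ring_scope.

Notation space R := (R * R * R)%type.
Notation spacetime R := (space R * R)%type.
Notation vfield R := ('I_3 -> spacetime R -> R).
Notation tfield R := ('I_3 -> 'I_3 -> spacetime R -> R).

Section Spacetime.
Variable R : realType.

Definition space_measure :
    {measure set (measurableTypeR R * measurableTypeR R * measurableTypeR R)
      -> \bar R} :=
  ((@lebesgue_measure R \x @lebesgue_measure R) \x @lebesgue_measure R)%E.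

Definition st_measure :
    {measure set (measurableTypeR R * measurableTypeR R * measurableTypeR R
                  * measurableTypeR R) -> \bar R} :=
  (space_measure \x @lebesgue_measure R)%E.

(* The product type [space R] carries the max norm, hence the explicit
   Euclidean length. *)
Definition sqlen (x : space R) : R := x.1.1 ^+ 2 + x.1.2 ^+ 2 + x.2 ^+ 2.

Definition eball (r : R) : set (space R) := [set x | sqlen x < r ^+ 2].

Definition Ilast : set R := `]-1, 0[%classic.

Definition Qcyl (r : R) : set (spacetime R) := eball r `*` Ilast.

Definition dilate (r : R) (A : set (space R)) : set (space R) :=
  [set r *: x | x in A].

Definition e_ (i : 'I_3) : space R :=
  (((i == 0%N :> nat)%:R, (i == 1%N :> nat)%:R), (i == 2%N :> nat)%:R).

Definition Dx (i : 'I_3) (f : spacetime R -> R) (z : spacetime R) : R :=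
  'D_((e_ i, 0) : spacetime R) f z.
Definition Dt (f : spacetime R -> R) (z : spacetime R) : R :=
  'D_((0, 1) : spacetime R) f z.
Definition lapl (f : spacetime R -> R) (z : spacetime R) : R :=
  \sum_(i < 3) Dx i (Dx i f) z.

Definition smooth (V : normedModType R) (f : V -> R) : Prop :=
  forall vs : seq V,
    let g := foldr (fun v h => fun x => 'D_v h x) f vs in
    continuous g /\ forall x v, derivable g x v.

Definition supp (V : topologicalType) (f : V -> R) : set V :=
  closure [set x | f x != 0].

Definition test_fun (V : normedModType R) (O : set V) (f : V -> R) : Prop :=
  [/\ smooth f, compact (supp f) & supp f `<=` O].

(* C_c^oo((-1,0]) : restrictions to (-1,0] of smooth functions, with support
   compact in (-1,0]; support may reach the final time 0. *)
Definition test_upto0 (f : R -> R) : Prop :=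
  smooth (f : R^o -> R) /\
  exists K : set R, [/\ compact K, K `<=` `]-1, 0]%classic &
    forall t, t <= 0 -> f t != 0 -> K t].

Definition st_test_upto0 (f : spacetime R -> R) : Prop :=
  smooth f /\
  exists K : set (spacetime R),
    [/\ compact K, K `<=` eball 1 `*` `]-1, 0]%classic &
        forall z, z.2 <= 0 -> f z != 0 -> K z].

Definition lpnorm (D : set (spacetime R)) (p : R) (f : spacetime R -> R)
  : \bar R := Lnorm st_measure p%:E (EFin \o (f \_ D)).

Definition inLp (D : set (spacetime R)) (p : R) (f : spacetime R -> R) : Prop :=
  (f \_ D) \in Lfun st_measure p%:E.

(* L^(3/2) in time with values in L^(3/2) in space is L^(3/2) of the product. *)
Definition in_Xsrc (F : tfield R) : Prop :=
  forall i j, inLp (Qcyl 1) (3 / 2) (F i j).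
Definition in_Yprs : (spacetime R -> R) -> Prop := inLp (Qcyl (1 / 2)) (3 / 2).
Definition in_Yharm : (spacetime R -> R) -> Prop := inLp (Qcyl (3 / 4)) (3 / 2).
Definition normYprs : (spacetime R -> R) -> \bar R :=
  lpnorm (Qcyl (1 / 2)) (3 / 2).
Definition normYharm : (spacetime R -> R) -> \bar R :=
  lpnorm (Qcyl (3 / 4)) (3 / 2).

Definition ae_eq_on (D : set (spacetime R)) (f g : spacetime R -> R) : Prop :=
  {ae st_measure, forall z, D z -> f z = g z}.

Definition weak_Dx (O : set (spacetime R)) (i : 'I_3)
    (f g : spacetime R -> R) : Prop :=
  forall phi, test_fun O phi ->
    \int[st_measure]_(z in O) (f z * Dx i phi z) =
    - \int[st_measure]_(z in O) (g z * phi z).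

Definition vabs (u : vfield R) (z : spacetime R) : R :=
  Num.sqrt (\sum_(i < 3) u i z ^+ 2).
Definition tabs (F : tfield R) (z : spacetime R) : R :=
  Num.sqrt (\sum_(i < 3) \sum_(j < 3) F i j z ^+ 2).
Definition tens (u : vfield R) : tfield R := fun i j z => u i z * u j z.

(* (-Delta)^(-1/2) on R^3, acting in space only: convolution with the Riesz
   kernel 1 / (2 pi^2 |x|^2). *)
Definition inv_sqrt_lapl (f : spacetime R -> R) (z : spacetime R) : R :=
  (2 * pi ^+ 2)^-1 *
  \int[space_measure]_(y in setT) (f (y, z.2) / sqlen (z.1 - y)).

Definition Qall : set (spacetime R) := setT `*` Ilast.

(* R_j = d_j (-Delta)^(-1/2) on L^(3/2); the value is one representative of
   the almost-everywhere class of the weak derivative. *)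
Definition riesz (j : 'I_3) (f : spacetime R -> R) : spacetime R -> R :=
  xget (fun=> 0)
    [set g | inLp Qall (3 / 2) g /\ weak_Dx Qall j (inv_sqrt_lapl f) g].

(* R_i R_j F_ij, summed over i and j, for F extended by zero outside B_1 *)
Definition rieszrieszF (F : tfield R) (z : spacetime R) : R :=
  \sum_(i < 3) \sum_(j < 3) riesz i (riesz j (F i j \_ (Qcyl 1))) z.

Section Lp_operators.
Variable D : set (spacetime R).
Let L : (spacetime R -> R) -> Prop := inLp D (3 / 2).
Let nrm : (spacetime R -> R) -> \bar R := lpnorm D (3 / 2).

Definition opnorm (T : (spacetime R -> R) -> (spacetime R -> R)) : \bar R :=
  ereal_sup [set nrm (T f) | f in [set f | L f /\ (nrm f <= 1)%E]].

Definition bounded_op (T : (spacetime R -> R) -> (spacetime R -> R)) : Prop :=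
  [/\ forall f, L f -> L (T f),
      forall (a : R) f g, L f -> L g ->
        ae_eq_on D (T (fun z => a * f z + g z)) (fun z => a * T f z + T g z) &
      (opnorm T < +oo)%E].

Definition finite_rank (T : (spacetime R -> R) -> (spacetime R -> R)) : Prop :=
  bounded_op T /\
  exists n (h : 'I_n -> spacetime R -> R), (forall i, L (h i)) /\
    forall f, L f -> exists c : 'I_n -> R,
      ae_eq_on D (T f) (fun z => \sum_(i < n) c i * h i z).

Definition precompact_Lp (G : set (spacetime R -> R)) : Prop :=
  forall eps : R, 0 < eps -> exists n (h : 'I_n -> spacetime R -> R),
    (forall i, L (h i)) /\
    forall f, G f -> exists i, (nrm (f \- h i)%R < eps%:E)%E.

End Lp_operators.

Definition distset (V : zmodType) (N : V -> R) (x : V) (A : set V) : R :=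
  inf [set N (x - y) | y in A].

Definition seminorm (V : lmodType R) (N : V -> R) : Prop :=
  [/\ forall x, 0 <= N x, forall a x, N (a *: x) = `|a| * N x &
      forall x y, N (x + y) <= N x + N y].

Definition subspace_of (V : lmodType R) (A : set V) : Prop :=
  A 0 /\ forall (a : R) x y, A x -> A y -> A (a *: x + y).

Definition finite_dim (V : lmodType R) : Prop :=
  exists n (b : 'I_n -> V), forall v, exists c : 'I_n -> R,
    v = \sum_(i < n) c i *: b i.

(* The functional [V] on the cone [C] descends to the quotient of [X] by the
   gauge [G], normed by the [N]-distance to [G]; on the unit section of that
   quotient it satisfies the hypotheses of the minimum principle. *)
Definition compact_quotient_criterion (X : lmodType R) (N : X -> R)
    (G : set X) (C : set X) (V : X -> R) : Prop :=
  exists (Q : normedModType R) (cls : {linear X -> Q}) (v : Q -> R),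
    let section := [set cls h | h in C] `&` [set q | `|q| = 1] in
    [/\ (forall q, exists h, cls h = q) /\
          (forall h, `|cls h| = distset N h G),
        forall h, C h -> V h = v (cls h) /\ 0 <= V h,
        compact section /\
          (forall q a, section q -> a < v q ->
            \forall q' \near within section (nbhs q), a < v q'),
        forall h (t : R), C h -> 0 <= t -> C (t *: h) /\ V (t *: h) = t * V h &
        forall h, C h -> V h = 0 -> cls h = 0].

End Spacetime.

Section Packages.
Variable R : realType.

Record geometry := Geometry {
  g_lam : R; g_r0 : R; g_x0 : space R; g_t0 : R;
  g_u : vfield R; g_p : spacetime R -> R;
  g_eta : space R -> R; g_chi : space R -> R; g_theta : R -> R;
  g_Cloc : R -> (space R -> R) -> (R -> R) -> R;
  g_Ceta : (space R -> R) -> R }.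

Definition geometry_ok (g : geometry) : Prop :=
  [/\ 0 < g_lam g < 1 /\ 0 < g_r0 g,
      test_fun (eball 1) (g_eta g) /\
        (forall x, eball (3 / 4) x -> g_eta g x = 1),
      test_fun (eball 1) (g_chi g) /\
        (forall x, eball (3 / 4) x -> g_chi g x = 1),
      test_upto0 (g_theta g) &
      0 < g_Cloc g (g_lam g) (g_chi g) (g_theta g) /\ 0 < g_Ceta g (g_eta g)].

(* f |-> r^m f(x0 + r y, t0 + r^2 s); m = 1 for velocity, 2 for pressure *)
Definition zoom (x0 : space R) (t0 r : R) (m : nat) (f : spacetime R -> R)
    (z : spacetime R) : R :=
  r ^+ m * f (x0 + r *: z.1, t0 + r ^+ 2 * z.2).

(* The functional coordinates U, P^act, P^harm and S = F^act are computed from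
   the velocity and the pressure, and delta from the gauge class; only the
   remaining coordinates are stored. [d_grad D i j] is d_j u_i. *)
Record package (X : lmodType R) (Gt : normedModType R) := Package {
  d_vel : vfield R; d_grad : tfield R; d_prs : spacetime R -> R;
  d_loc : R; d_gate : Gt; d_rep : X; d_det : R; d_budget : R }.

Record coords (Gt : Type) := Coords {
  co_U : vfield R; co_Pact : spacetime R -> R; co_Pharm : spacetime R -> R;
  co_S : tfield R; co_L : R; co_G : Gt }.

Section Coordinates.
Variables (g : geometry) (X : lmodType R) (Gt : normedModType R).
Implicit Type D : package X Gt.

Definition Fact D : tfield R := fun i j z => g_eta g z.1 * tens (d_vel D) i j z.
Definition Pact_full D : spacetime R -> R := rieszrieszF (Fact D).
Definition Pact D : spacetime R -> R := Pact_full D \_ (Qcyl (1 / 2)).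
Definition Pharm D : spacetime R -> R :=
  (fun z => d_prs D z - Pact_full D z) \_ (Qcyl (3 / 4)).

Definition coords_of D : coords Gt :=
  Coords (fun i => d_vel D i \_ (Qcyl 1)) (Pact D) (Pharm D)
    (fun i j => Fact D i j \_ (Qcyl 1)) (d_loc D) (d_gate D).

(* sum over i, j of [eta, R_i R_j] (u_i u_j) *)
Definition pressure_commutator D (z : spacetime R) : R :=
  g_eta g z.1 * rieszrieszF (tens (d_vel D)) z - rieszrieszF (Fact D) z.

Definition A_eta : set (space R) :=
  eball 1 `&` supp (fun x => 1 - g_eta g x).
Definition Omega_chi : set (space R) := supp (g_chi g).
Definition A_chi : set (space R) :=
  closure [set x | exists i, 'D_(e_ R i) (g_chi g) x != 0] `|`
  supp (fun x => \sum_(i < 3) 'D_(e_ R i) (fun y => 'D_(e_ R i) (g_chi g) y) x).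

Definition Leak D : \bar R :=
  let l := g_lam g in let u := vabs (d_vel D) in
  let I := `](- l ^+ 2), 0[%classic in
  (\int[st_measure R]_(z in dilate l Omega_chi `*` I)
      (u z ^+ 2 + tabs (d_grad D) z ^+ 2)%:E +
   \int[st_measure R]_(z in dilate l A_chi `*` I)
      (u z ^+ 2 + u z ^+ 3 + `|d_prs D z| * u z)%:E)%E.

Definition slice_energy (u : vfield R) (t : R) : \bar R :=
  (\int[@space_measure R]_(x in eball 1%R) (vabs u (x, t) ^+ 2)%:E)%E.

(* Unit viscosity, no force. *)
Record suitable_weak_solution (u : vfield R) (Du : tfield R)
    (p : spacetime R -> R) : Prop := {
  sws_L3 : forall i, inLp (Qcyl 1) 3 (u i);
  sws_LinfL2 :
    (ess_sup (@lebesgue_measure R) (slice_energy u \_ (@Ilast R)) < +oo)%E;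
  sws_grad : forall i j, weak_Dx (Qcyl 1) j (u i) (Du i j);
  sws_gradL2 : forall i j, inLp (Qcyl 1) 2 (Du i j);
  sws_prs : inLp (Qcyl 1) (3 / 2) p;
  sws_div : forall phi, test_fun (Qcyl 1) phi ->
    \int[@st_measure R]_(z in Qcyl 1) (\sum_(i < 3) u i z * Dx i phi z) = 0;
  sws_momentum : forall phi i, test_fun (Qcyl 1) phi ->
    \int[@st_measure R]_(z in Qcyl 1)
      (u i z * Dt phi z + \sum_(j < 3) u i z * u j z * Dx j phi z
       + p z * Dx i phi z + u i z * lapl phi z) = 0;
  (* - Delta p = d_i d_j (u_i u_j), tested on Q_1; insensitive to adding to p
     a function of time *)
  sws_pressure : forall phi, test_fun (Qcyl 1) phi ->
    \int[@st_measure R]_(z in Qcyl 1) (p z * - lapl phi z) =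
    \int[@st_measure R]_(z in Qcyl 1)
      (\sum_(i < 3) \sum_(j < 3) u i z * u j z * Dx i (Dx j phi) z);
  sws_energy : forall phi, st_test_upto0 phi -> (forall z, 0 <= phi z) ->
    {ae @lebesgue_measure R, forall t : R, -1 < t < 0 ->
      \int[@space_measure R]_(x in eball 1) (vabs u (x, t) ^+ 2 * phi (x, t))
      + 2 * \int[@st_measure R]_(z in eball 1 `*` `]-1, t[%classic)
              (tabs Du z ^+ 2 * phi z)
      <= \int[@st_measure R]_(z in eball 1 `*` `]-1, t[%classic)
           (vabs u z ^+ 2 * (Dt phi z + lapl phi z)
            + (vabs u z ^+ 2 + 2 * p z) * \sum_(i < 3) u i z * Dx i phi z)} }.

Record ns_package (k : nat) D : Prop := {
  np_vel : forall i z, Qcyl 1 z ->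
    d_vel D i z = zoom (g_x0 g) (g_t0 g) (g_lam g ^+ k * g_r0 g) 1 (g_u g i) z;
  np_prs : forall z, Qcyl 1 z ->
    d_prs D z = zoom (g_x0 g) (g_t0 g) (g_lam g ^+ k * g_r0 g) 2 (g_p g) z;
  np_sws : suitable_weak_solution (d_vel D) (d_grad D) (d_prs D) }.

End Coordinates.

(* Index [k] is the scale. The gauge class [f_Gam k] lives in the space
   [f_X k] of audit vectors, [f_vec k] sends the coordinates of a package to
   its audit vector, and [f_nrm0 k] is |.|_{0,k}. [f_P k N] and [f_H k M] are
   P^cl_{N,k} and H^harm_{M,k}; [f_N] and [f_M] are the truncation levels used
   on the chain. [f_Src k] is the set of sources whose pressure images are the
   selected clean ones. The chart and T^PFE share the clean space [f_Cl k].
   [f_adm k] is a cone of audit differences on which the visibility functional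
   is considered; [f_ell] is the residual-loss coefficient L^res. *)
Record frame := Frame {
  f_X : nat -> lmodType R;
  f_Gate : nat -> normedModType R;
  f_vec : forall k, coords (f_Gate k) -> f_X k;
  f_nrm0 : forall k, f_X k -> R;
  f_Gam : forall k, set (f_X k);
  f_transport : forall k, f_X k -> f_X k.+1;
  f_disc : forall k, f_X k -> f_X k -> R;
  f_eps : nat -> R;
  f_Kgate : forall k, set (f_Gate k);
  f_N : nat;
  f_M : nat;
  f_P : nat -> nat -> (spacetime R -> R) -> (spacetime R -> R);
  f_H : nat -> nat -> (spacetime R -> R) -> (spacetime R -> R);
  f_Src : nat -> set (tfield R);
  f_Pobs : nat -> spacetime R -> R;
  f_Hobs : nat -> spacetime R -> R;
  f_Red : nat -> normedModType R;
  f_Loc : nat -> normedModType R;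
  f_Cl : nat -> normedModType R;
  f_Tax : nat -> normedModType R;
  f_red : forall k, f_X k -> f_Red k;
  f_Theta : forall k, f_Red k -> f_Cl k;
  f_Tloc : forall k, f_Red k -> f_Loc k;
  f_Tpfe : forall k, {linear f_Cl k -> f_Tax k};
  f_J : forall k, f_Loc k -> f_Tax k;
  f_Err : forall k, f_Red k -> R;
  f_Cres : nat -> R;
  f_cJ : nat -> R;
  f_Ddet : nat -> R;
  f_DJ : nat -> R;
  f_adm : forall k, set (f_X k);
  f_chart : forall k, f_X k -> f_Cl k;
  f_Gcl : forall k, set (f_Cl k);
  f_Mcomp : forall k, f_Cl k -> R;
  f_ChartErr : nat -> R;
  f_GapErr : nat -> R;
  f_mu : nat -> R;
  f_lamG : nat -> R;
  f_ell : nat -> R }.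

Record ledger := Ledger {
  l_sync : R; l_loc : R; l_proj : R; l_harm : R;
  l_chart : R; l_gap : R; l_gate : R; l_det : R }.

Definition ledger_total (l : ledger) : R :=
  l_sync l + l_loc l + l_proj l + l_harm l +
  l_chart l + l_gap l + l_gate l + l_det l.

Section Chain.
Variables (g : geometry) (S : frame).

Definition pkg (k : nat) := package (f_X S k) (f_Gate S k).

Definition frame_ok (k : nat) : Prop :=
  [/\ seminorm (@f_nrm0 S k),
      [/\ finite_dim (f_Gate S k), closed (@f_Kgate S k) & @f_Kgate S k !=set0],
      [/\ finite_dim (f_Red S k), finite_dim (f_Loc S k), finite_dim (f_Cl S k)
        & finite_dim (f_Tax S k)],
      subspace_of (@f_Gcl S k) &
      [/\ forall N, finite_rank (Qcyl (1 / 2)) (f_P S k N) &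
          forall M, finite_rank (Qcyl (3 / 4)) (f_H S k M)]].

Definition vec (k : nat) (D : pkg k) : f_X S k := f_vec (coords_of g D).

Definition delta (k : nat) (D : pkg k) : R :=
  distset (@f_nrm0 S k) (vec D) (@f_Gam S k).

Definition near_minimizer (k : nat) (D : pkg k) : Prop :=
  [/\ 0 <= f_eps S k, @f_Gam S k (d_rep D) &
      @f_nrm0 S k (vec D - d_rep D) <= delta D + f_eps S k].

Definition clean_images (k : nat) : set (spacetime R -> R) :=
  [set rieszrieszF F \_ (Qcyl (1 / 2)) | F in @f_Src S k].

Record one_step (k : nat) (D : pkg k) (D' : pkg k.+1) (l : ledger) : Prop := {
  os_class : ns_package g k D;
  os_vel : forall i z, Qcyl 1 z ->
    d_vel D' i z = zoom 0 0 (g_lam g) 1 (d_vel D i) z;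
  os_prs : forall z, Qcyl 1 z ->
    d_prs D' z = zoom 0 0 (g_lam g) 2 (d_prs D) z;
  os_U : forall i, inLp (Qcyl 1) 3 (d_vel D i);
  os_F : in_Xsrc (Fact g D);
  os_act : in_Yprs (Pact g D);
  os_harm : in_Yharm (Pharm g D);
  (* eta = 1 on the whole of B_{3/4}, where P^harm is defined *)
  os_harmonic : forall phi, test_fun (Qcyl (3 / 4)) phi ->
    \int[@st_measure R]_(z in Qcyl (3 / 4)) (Pharm g D z * lapl phi z) = 0;
  os_loc : ((g_Cloc g (g_lam g) (g_chi g) (g_theta g))%:E * Leak g D
            <= (l_loc l)%:E)%E;
  os_comm : (normYprs (pressure_commutator g D) <=
    (g_Ceta g (g_eta g))%:E *
    lpnorm (A_eta g `*` @Ilast R) (3 / 2)%R (tabs (tens (d_vel D))))%E;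
  os_near : near_minimizer D /\ near_minimizer D';
  os_transport : forall zeta, @f_Gam S k zeta ->
    @f_Gam S k.+1 (@f_transport S k zeta);
  os_disc : forall zeta zeta', 0 <= @f_disc S k.+1 zeta zeta';
  os_sync : @f_disc S k.+1 (d_rep D') (@f_transport S k (d_rep D))
            + f_eps S k + f_eps S k.+1 <= l_sync l;
  os_Pobs : in_Yprs (f_Pobs S k.+1) /\ clean_images k.+1 (f_Pobs S k.+1);
  os_proj : (normYprs (f_Pobs S k.+1 \-
      f_P S k.+1 (f_N S) (f_Pobs S k.+1))%R <= (l_proj l)%:E)%E;
  os_Hobs : in_Yharm (f_Hobs S k.+1);
  os_harmtail : (normYharm (f_Hobs S k.+1 \-
      f_H S k.+1 (f_M S) (f_Hobs S k.+1))%R <= (l_harm l)%:E)%E;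
  os_gate : distset (fun x => `|x|) (d_gate D') (@f_Kgate S k.+1) <= l_gate l;
  os_pfe : forall x : f_Red S k,
    `|f_Tpfe S k (f_Theta x) - @f_J S k (f_Tloc x)|
      <= f_Cres S k * f_Err x + f_Ddet S k;
  os_J : 0 < f_cJ S k /\ forall x : f_Red S k,
    f_cJ S k * `|@f_J S k (f_Tloc x)| - f_DJ S k <= `|f_Tloc x|;
  os_det : f_cJ S k * f_Cres S k * f_Err (f_red (vec D - d_rep D))
           + f_cJ S k * f_Ddet S k + f_DJ S k <= l_det l;
  os_chart : f_ChartErr S k <= l_chart l;
  os_gap : f_GapErr S k <= l_gap l }.

Definition coef (k : nat) : R := f_mu S k * f_lamG S k - f_ell S k.

Definition coef_min (K : nat) : R := \big[Num.min/coef 0]_(k < K.+1) coef k.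

Definition eta_coeff (dmu dlam dell : nat -> R) (k : nat) : R :=
  f_mu S k * f_lamG S k
  - Num.max (f_mu S k - dmu k) 0 * Num.max (f_lamG S k - dlam k) 0 + dell k.

Definition coefficient_drift (K : nat) : Prop :=
  exists dmu dlam dell : nat -> R, forall k, (k < K)%N ->
    [/\ [/\ 0 <= dmu k, 0 <= dlam k & 0 <= dell k],
        Num.max (f_mu S k - dmu k) 0 <= f_mu S k.+1,
        Num.max (f_lamG S k - dlam k) 0 <= f_lamG S k.+1,
        f_ell S k.+1 <= f_ell S k + dell k &
        coef k - eta_coeff dmu dlam dell k <= coef k.+1].

Definition proj_tail (k N : nat) : \bar R :=
  ereal_sup [set normYprs (h \- f_P S k N h) | h in clean_images k].

Definition proj_compact (k : nat) : Prop :=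
  [/\ precompact_Lp (Qcyl (1 / 2)) (clean_images k),
      exists C : R, forall N, (opnorm (Qcyl (1 / 2)) (f_P S k N) <= C%:E)%E &
      forall h, in_Yprs h ->
        (fun N => normYprs (f_P S k N h \- h)) @ \oo --> 0%E].

Definition proj_effective (k : nat) : Prop :=
  exists eps : nat -> R,
    (forall N, (proj_tail k N <= (eps N)%:E)%E) /\ eps @ \oo --> 0.

(* Drift from scale k to k+1 along a transport [T]: the image defect is the
   one-sided Hausdorff distance of the new clean images from the transported
   ones, the commutator is that of [T] with the projections. *)
Definition proj_drift (k : nat) : Prop :=
  exists T : (spacetime R -> R) -> (spacetime R -> R),
    bounded_op (Qcyl (1 / 2)) T /\
    let image_defect := ereal_sup
      [set ereal_inf [set normYprs (h' \- T h) | h in clean_images k]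
      | h' in clean_images k.+1] in
    forall N, let commutator := ereal_sup
      [set normYprs (T (f_P S k N h) \- f_P S k.+1 N (T h))
      | h in clean_images k] in
    (proj_tail k.+1 N <=
     (1 + opnorm (Qcyl (1 / 2)) (f_P S k.+1 N)) * image_defect +
     opnorm (Qcyl (1 / 2)) T * proj_tail k N + commutator)%E.

(* The drift alternative controls the tail at its arrival scale. *)
Definition projection_tail_control (k : nat) : Prop :=
  [/\ forall F, @f_Src S k F -> in_Xsrc F,
      forall h, clean_images k h -> in_Yprs h &
      [\/ proj_compact k, proj_effective k |
          exists2 j : nat, k = j.+1 & proj_drift j]].

Definition clean_dist (k : nat) (x : f_Cl S k) : R :=
  distset (fun y => `|y|) x (@f_Gcl S k).

Definition chart_fun (k : nat) (h : f_X S k) : R := clean_dist (f_chart h).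

Definition chart_visibility (k : nat) (D : pkg k) : Prop :=
  [/\ 0 < f_lamG S k,
      f_lamG S k * delta D <= chart_fun (vec D - d_rep D),
      @f_adm S k (vec D - d_rep D) &
      compact_quotient_criterion (@f_nrm0 S k) (@f_Gam S k) (@f_adm S k)
        (@chart_fun k)].

Definition pfe_gap (k : nat) (muPFE : R) : Prop :=
  [/\ [set x | f_Tpfe S k x = 0] = @f_Gcl S k, 0 < muPFE &
      forall x, muPFE * clean_dist x <= `|f_Tpfe S k x|].

Definition clean_gap (k : nat) : Prop :=
  [/\ 0 < f_mu S k,
      forall x, f_mu S k * clean_dist x <= @f_Mcomp S k x &
      compact_quotient_criterion (fun x : f_Cl S k => `|x|) (@f_Gcl S k) setT
        (@f_Mcomp S k)
      \/ ((forall x, @f_Mcomp S k x = `|f_Tpfe S k x|) /\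
          exists2 muPFE, pfe_gap k muPFE & f_mu S k = muPFE)].

End Chain.

End Packages.

(* Main.v *)
Require Import Defs.
From HB Require Import structures.
From mathcomp Require Import all_boot all_order all_algebra.
From mathcomp Require Import all_classical all_reals all_analysis.
From mathcomp Require Import lra.
Import Order.TTheory GRing.Theory Num.Theory.
Import numFieldNormedType.Exports.
Local Open Scope classical_set_scope.
Local Open Scope ring_scope.

(** The recursive audit is the static certificate summed over scales. Since each defect distance is
    nonnegative ([distset_ge0]) and [coef_min S K] lies below every [coef S k] ([coef_min_le]), all
    coefficients can be replaced by the minimal one before weighting and summing. The budget bound
    is the solution of a linear recursive inequality ([discrete_gronwall]). The dichotomy follows
    because the detector total and the recursive budget add up to at least
    [coef_min S K * total_defect], so both cannot fall below half of it. *)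

Lemma distset_ge0 (R : realType) (V : zmodType) (N : V -> R) (x : V)
    (A : set V) : (forall y, 0 <= N y) -> 0 <= distset N x A.
Proof.
move=> N_ge0; rewrite /distset.
(* An empty [A] is treated apart: there [inf] takes its default value 0. *)
have [->|/set0P neq0] := eqVneq [set N (x - y) | y in A] set0.
  by rewrite inf0.
by apply: lb_le_inf => // _ [y _ <-].
Qed.

(** Unrolls the recursion: a loss entering at step [j] is amplified by every later factor [a i].
    Nonnegativity of [a k] allows the inductive bound to be multiplied by it. *)
Lemma discrete_gronwall (R : realDomainType) (K : nat) (a b d E : nat -> R) :
  (forall k, (k < K)%N -> 0 <= a k) ->
  (forall k, (k < K)%N -> E k.+1 <= a k * E k + b k * d k) ->
  forall k, (k <= K)%N ->
    E k <= (\prod_(0 <= i < k) a i) * E 0%N +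
           \sum_(0 <= j < k) b j * (\prod_(j.+1 <= i < k) a i) * d j.
Proof.
move=> a_ge0 step; elim=> [_|k IH ltkK].
  by rewrite !big_geq // mul1r addr0.
apply: (le_trans (step k ltkK)).
rewrite big_nat_recr //= [X in _ <= _ + X]big_nat_recr //=.
(* The newest loss, [j = k], carries an empty product and cancels against the [b k * d k] of the
   recursion. *)
rewrite [X in b k * X * _](big_geq (leqnn _)) mulr1 addrA lerD2r.
(* Each older loss gains exactly the factor [a k], which leaves the sum. *)
have -> : \sum_(0 <= j < k) b j * (\prod_(j.+1 <= i < k.+1) a i) * d j =
    a k * \sum_(0 <= j < k) b j * (\prod_(j.+1 <= i < k) a i) * d j.
  rewrite big_distrr; apply: eq_big_nat => j /andP[_ ltjk].
  by rewrite big_nat_recr //= [RHS]mulrC -!mulrA [d j * a k]mulrC.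
rewrite [_ * a k]mulrC -mulrA -mulrDr.
by apply: ler_wpM2l; [exact: a_ge0|exact/IH/ltnW].
Qed.

Lemma coef_min_le (R : realType) (S : frame R) (K k : nat) :
  (k <= K)%N -> coef_min S K <= coef S k.
Proof.
rewrite -ltnS => ltkK; rewrite /coef_min.
exact: (@bigmin_le_cond _ _ _ _ (Ordinal ltkK) xpredT (fun i : 'I_K.+1 => coef S i)).
Qed.

Theorem theorem17p1 (R : realType) (g : geometry R) (S : frame R) (K : nat)
    (D : forall k : nat, pkg S k) (Delta : nat -> ledger R)
    (a b eta : nat -> R)
    (geometryP : geometry_ok g)
    (frameP : forall k, (k <= K)%N -> frame_ok S k)
    (packageP : forall k, (k <= K)%N -> ns_package g k (D k))
    (coef_ge0 : forall k, (k <= K)%N -> 0 <= coef S k)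
    (one_stepP : forall k, (k < K)%N -> one_step g (D k) (D k.+1) (Delta k))
    (static_audit : forall k, (k <= K)%N ->
      coef S k * delta g (D k) - d_budget (D k) <= d_det (D k))
    (abeta_ge0 : forall k, (k < K)%N -> [/\ 0 <= a k, 0 <= b k & 0 <= eta k])
    (budget_step : forall k, (k < K)%N ->
      d_budget (D k.+1) <= a k * d_budget (D k) + b k * ledger_total (Delta k))
    (coef_step : forall k, (k < K)%N -> coef S k - eta k <= coef S k.+1)
    (driftP : coefficient_drift S K \/ 0 < coef_min S K)
    (projectionP : forall k, (k <= K)%N -> projection_tail_control S k)
    (chartP : forall k, (k <= K)%N -> chart_visibility g (D k))
    (gapP : forall k, (k <= K)%N -> clean_gap S k)
    (w : nat -> R) (w_ge0 : forall k, (k <= K)%N -> 0 <= w k) :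
  let E_rec := \sum_(k < K.+1) w k * d_budget (D k) in
  let total_det := \sum_(k < K.+1) w k * d_det (D k) in
  let total_defect := \sum_(k < K.+1) w k * delta g (D k) in
  [/\ coef_min S K * total_defect - E_rec <= total_det,
      forall k, (k <= K)%N ->
        d_budget (D k) <=
          (\prod_(0 <= i < k) a i) * d_budget (D 0%N) +
          \sum_(0 <= j < k)
            b j * (\prod_(j.+1 <= i < k) a i) * ledger_total (Delta j) &
      coef_min S K / 2 * total_defect <= total_det \/
      coef_min S K / 2 * total_defect <= E_rec].
Proof.
move=> E_rec total_det total_defect.
have audit : coef_min S K * total_defect - E_rec <= total_det.
  rewrite mulr_sumr -sumrB; apply: ler_sum => k _.
  have lekK : (k <= K)%N := ltn_ord k.
  have [[nrm_ge0 _ _] _ _ _ _] := frameP _ lekK.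
  (* With the weight [w k] factored out, the claim is the certificate at one scale with the
     coefficient lowered to the minimum. *)
  rewrite mulrCA -mulrBr; apply: ler_wpM2l; first exact: w_ge0.
  apply: le_trans (static_audit _ lekK); rewrite lerD2r.
  by apply: ler_wpM2r; [exact: distset_ge0|exact: coef_min_le].
split=> //.
- apply: (@discrete_gronwall R K a b (fun k => ledger_total (Delta k))
    (fun k => d_budget (D k))) => // k ltkK.
  by case: (abeta_ge0 k ltkK).
(* If the detector total is below half, [audit] forces the budget to cover the other half. *)
- have [le_det|lt_det] := leP (coef_min S K / 2 * total_defect) total_det.
    by left.
  by right; lra.
Qed.
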